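(* Let $w\in S_\infty$ and $i\ge1$ with $l(ws_i)=l(w)-1$. Then: (1) the sets $\mathrm{mitosis}'_i(D)$, $D\in\mathcal P_s(w)$, are pairwise disjoint and $\bigsqcup_{D\in\mathcal P_s(w)}\mathrm{mitosis}'_i(D)=\mathcal P(ws_i)$; (2) the sets $\mathrm{mitosis}'_i(D)$, $D\in\mathcal P_I(w)$, are pairwise disjoint and $\bigsqcup_{D\in\mathcal P_I(w)}\mathrm{mitosis}'_i(D)=\mathcal P_\varnothing(w)$.
   Context: Permutations: $S_\infty=\bigcup_n S_n$ is generated by the simple transpositions $s_a=(a\ a{+}1)$, $a\ge 1$; $l(w)$ is the Coxeter length of $w$. A pipe dream is a finite subset $D\subset\mathbb{Z}_{>0}\times\mathbb{Z}_{>0}$; its elements $(r,c)$ are called crosses (in row $r$, column $c$). The reading word of $D$ is obtained by listing the crosses row by row from top to bottom, within each row from right to left (decreasing $c$), and recording for each cross $(r,c)$ its antidiagonal index $r+c-1$; this gives a word $(a_1,\dots,a_k)$. For $u\in S_\infty$ put $u\star s_a=us_a$ if $l(us_a)=l(u)+1$ and $u\star s_a=u$ otherwise. The Demazure product of $D$ is $\delta(D)=(\cdots((e\star s_{a_1})\star s_{a_2})\cdots)\star s_{a_k}$. For $w\in S_\infty$, $\mathcal P(w)=\{D:\delta(D)=w\}$. Mitosis: $\mathrm{start}_i(D)=\min\{c\ge 1:(i,c)\notin D\}$, $\mathcal J_i(D)=\{c<\mathrm{start}_i(D): (i+1,c)\notin D\}$. For $p\in\mathcal J_i(D)$, $D_p=\big(D\setminus(\{(i,p)\}\cup\{(i,c):c\in\mathcal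 J_i(D),c<p\})\big)\cup\{(i+1,c):c\in\mathcal J_i(D),c<p\}$ (delete $(i,p)$ and move each $(i,c)$, $c\in\mathcal J_i(D)$, $c<p$, down to $(i+1,c)$). $\mathrm{mitosis}_i(D)=\{D_p:p\in\mathcal J_i(D)\}$. If $\mathcal J_i(D)=\{j_1<\dots<j_k\}$, then $\mathrm{mitosis}'_i(D)=\{D_{j_1},\,D_{j_1}\cup D_{j_2},\,D_{j_2},\,\dots,\,D_{j_{k-1}}\cup D_{j_k},\,D_{j_k}\}$; it is empty if $\mathcal J_i(D)=\emptyset$. Partition of $\mathcal P(w)$ (for fixed $i$ with $l(ws_i)=l(w)-1$): $\mathcal P_\varnothing(w)=\{D\in\mathcal P(w):\mathcal J_i(D)=\emptyset\}$; $\mathcal P_s(w)=\{D\in\mathcal P(w):\mathcal J_i(D)\ne\emptyset,\ \mathrm{mitosis}_i(D)\subseteq\mathcal P(ws_i)\}$; $\mathcal P_I(w)=\{D\in\mathcal P(w):\mathcal J_i(D)\neq\emptyset,\ \mathrm{mitosis}_i(D)\subseteq\mathcal P(w)\}$. (Every $D\in\mathcal P(w)$ with $\mathcal J_i(D)\ne\emptyset$ lies in exactly one of $\mathcal P_s(w)$, $\mathcal P_I(w)$.) *)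

(* Defs.v *)
From mathcomp Require Import all_boot.
Set Implicit Arguments. Unset Strict Implicit. Unset Printing Implicit Defensive.

(* ---------- Permutations of S_infinity ----------
   A permutation w in S_infty is represented by a finite one-line word
   [:: w(1); ...; w(n)] (a seq nat which is a rearrangement of 1..n);
   w(k) = k for k > n.  Different paddings by trailing fixed points
   represent the same permutation; equality of permutations is [peq]. *)

Definition pval (s : seq nat) (k : nat) : nat :=
  if k is 0 then 0 else nth k s k.-1.

Definition peq (s t : seq nat) : Prop := pval s =1 pval t.

Definition len (s : seq nat) : nat :=
  \sum_(0 <= a < size s) \sum_(a.+1 <= b < size s) (nth 0 s b < nth 0 s a).

Definition ext (n : nat) (s : seq nat) : seq nat :=
  s ++ iota (size s).+1 (n - size s).

(* right multiplication u * s_a  (a >= 1): swap the values at positions a, a+1 *)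
Definition mulS (u : seq nat) (a : nat) : seq nat :=
  let t := ext a.+1 u in
  [seq nth 0 t (if k == a.-1 then a else if k == a then a.-1 else k)
  | k <- iota 0 (size t)].

Definition star (u : seq nat) (a : nat) : seq nat :=
  if len (mulS u a) == (len u).+1 then mulS u a else u.

(* ---------- Pipe dreams ----------
   A pipe dream (finite subset of Z>0 x Z>0) is represented canonically by
   the seq of its crosses listed in reading order (rows top to bottom,
   within a row right to left), without repetition. *)

Definition rlt (x y : nat * nat) : bool :=
  (x.1 < y.1) || ((x.1 == y.1) && (y.2 < x.2)).
Definition rle (x y : nat * nat) : bool :=
  (x.1 < y.1) || ((x.1 == y.1) && (y.2 <= x.2)).

Definition pd_wf (D : seq (nat * nat)) : bool :=
  sorted rlt D && all (fun x => (0 < x.1) && (0 < x.2)) D.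

Definition mkpd (s : seq (nat * nat)) : seq (nat * nat) := sort rle (undup s).

(* reading word: antidiagonal indices r + c - 1 in reading order *)
Definition readword (D : seq (nat * nat)) : seq nat :=
  [seq (x.1 + x.2).-1 | x <- mkpd D].

Definition demazure (D : seq (nat * nat)) : seq nat :=
  foldl star [::] (readword D).

Definition inP (w : seq nat) (D : seq (nat * nat)) : Prop :=
  pd_wf D /\ peq (demazure D) w.

Lemma start_ex (i : nat) (D : seq (nat * nat)) :
  exists c, (0 < c) && ((i, c) \notin D).
Proof.
exists (foldr (fun x m => maxn x.2 m) 0 D).+1; apply/andP; split => //.
suff H : forall x, x \in D -> x.2 <= foldr (fun x m => maxn x.2 m) 0 D.
  by apply/negP => /H /=; rewrite ltnn.
elim: D => [|y D IH] x //=; rewrite inE => /orP [/eqP -> | /IH H].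
  by rewrite leq_maxl.
by rewrite (leq_trans H) // leq_maxr.
Qed.

Definition start (i : nat) (D : seq (nat * nat)) : nat := ex_minn (start_ex i D).

Definition Jset (i : nat) (D : seq (nat * nat)) : seq nat :=
  [seq c <- iota 1 (start i D).-1 | (i.+1, c) \notin D].

Definition Dp (i : nat) (D : seq (nat * nat)) (p : nat) : seq (nat * nat) :=
  mkpd ([seq x <- D | (x != (i, p)) &&
            ~~ [&& x.1 == i, x.2 \in Jset i D & x.2 < p]]
        ++ [seq (i.+1, c) | c <- Jset i D & c < p]).

Definition mitosis (i : nat) (D : seq (nat * nat)) : seq (seq (nat * nat)) :=
  [seq Dp i D p | p <- Jset i D].

Definition mitosis' (i : nat) (D : seq (nat * nat)) : seq (seq (nat * nat)) :=
  match mitosis i D with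
  | [::] => [::]
  | d :: ds => d :: flatten [seq [:: mkpd (ab.1 ++ ab.2); ab.2] | ab <- zip (d :: ds) ds]
  end.

Definition P_empty (w : seq nat) (i : nat) (D : seq (nat * nat)) : Prop :=
  inP w D /\ Jset i D = [::].
Definition P_s (w : seq nat) (i : nat) (D : seq (nat * nat)) : Prop :=
  [/\ inP w D, Jset i D <> [::] & forall E, E \in mitosis i D -> inP (mulS w i) E].
Definition P_I (w : seq nat) (i : nat) (D : seq (nat * nat)) : Prop :=
  [/\ inP w D, Jset i D <> [::] & forall E, E \in mitosis i D -> inP w E].

(* Main.v *)
Require Import Defs.
From mathcomp Require Import all_boot.
From mathcomp Require Import zify.
Set Implicit Arguments. Unset Strict Implicit. Unset Printing Implicit Defensive.

(** Rows above [i] and below [i+1] are untouched by mitosis, and the letters of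
    the rows below [i+1] commute with [s_i]; so everything takes place in the
    two rows [i], [i+1], which up to commutations may be read column by column,
    from right to left.  Call a column T, L, B or 0 according to which of its two
    crosses are present (top, bottom, both, none).  The first columns of [D]
    are T's and B's, up to the first missing top cross.  The members of
    [mitosis'_i D] are obtained by turning an initial segment of the T's into
    L's and the next T into 0, or, if that segment is nonempty, keeping it.
    Multiplying such an [E] on the right by [s_i], the generator is carried
    through the columns ([B_c s_c = s_{c+1} B_c], [L_c s_c = s_{c+1} T_c]) and is
    absorbed in the 0 or the T, giving [D]: hence [delta E * s_i = delta D].
    The same computation shows that all members of [mitosis'_i D] have the same
    Demazure product, which is therefore [w] or [w s_i] if [delta D = w].
    Finally [E] with [J_i E] empty determines [D]: the modified T sits at the first
    missing bottom cross of [E]. *)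

(** * Length as a number of inversions, and [star] on one-line notation *)

Fixpoint inversions (s : seq nat) : nat :=
  if s is x :: s' then count (fun y => y < x) s' + inversions s' else 0.

Lemma lenE s : len s = inversions s.
Proof.
elim: s => [|x s IH]; first by rewrite /len /= big_nil.
rewrite /len /= big_nat_recl // big_add1 /=; congr (_ + _).
  rewrite -sum1_count [RHS]big_mkcond [RHS](big_nth 0) /=.
  by apply: eq_bigr => b _ /=; case: (_ < _).
by rewrite -IH /len; apply: eq_bigr => a _; rewrite big_add1.
Qed.

Lemma inversions_swap s1 x y s2 :
  inversions (s1 ++ y :: x :: s2) + (y < x) =
  inversions (s1 ++ x :: y :: s2) + (x < y).
Proof.
elim: s1 => [|z s1 IH] /=; first by lia.
by rewrite -addnA IH addnA !count_cat /=; lia.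
Qed.

(** This invariant of [mulS] is what padding needs: appended fixed points exceed all earlier
    entries, so [ext] creates no inversion. *)
Definition bounded_word (u : seq nat) : bool := all (fun x => x <= size u) u.

Lemma inversions_cat_iota m k u :
  all (fun x => x < m) u -> inversions (u ++ iota m k) = inversions u.
Proof.
elim: u => [|x u IH] /=.
  move=> _; elim: k m => //= k IH m; rewrite IH addn0; apply/eqP.
  rewrite -leqn0 leqNgt -has_count; apply/hasPn => y.
  by rewrite mem_iota; lia.
case/andP=> Hx Hu; rewrite IH // count_cat; congr (_ + _).
rewrite -[RHS]addn0; congr (_ + _); apply/eqP.
rewrite -leqn0 leqNgt -has_count; apply/hasPn => y.
by rewrite mem_iota; lia.
Qed.

Lemma inversions_ext n u : bounded_word u -> inversions (ext n u) = inversions u.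
Proof. by move=> Hu; apply: inversions_cat_iota. Qed.

Lemma size_ext n u : size (ext n u) = maxn (size u) n.
Proof. by rewrite /ext size_cat size_iota; lia. Qed.

Lemma nth_ext n u k : k < maxn (size u) n -> nth 0 (ext n u) k = pval u k.+1.
Proof.
move=> Hk; rewrite /ext /= nth_cat; case: ltnP => Hs.
  exact: set_nth_default.
by rewrite nth_iota ?nth_default //; lia.
Qed.

Lemma size_mulS u a : size (mulS u a) = maxn (size u) a.+1.
Proof. by rewrite /mulS size_map size_iota size_ext. Qed.

Definition swap_pos (a k : nat) : nat :=
  if k == a then a.+1 else if k == a.+1 then a else k.

Lemma pval_mulS u a k : 0 < a -> pval (mulS u a) k = pval u (swap_pos a k).
Proof.
case: a => // a _; case: k => [|k] //.
rewrite /swap_pos !eqSS [in LHS]/pval.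
case: (ltnP k (maxn (size u) a.+2)) => Hk.
  rewrite (nth_map 0) ?size_iota ?size_ext // nth_iota ?size_ext // add0n /=.
  case: eqP => Hka; first by rewrite nth_ext //; lia.
  by case: eqP => Hka'; rewrite nth_ext //; lia.
(* Beyond the padded word both sides are the default value of [pval], the position itself. *)
rewrite nth_default ?size_mulS //.
have -> : (k == a) = false by lia.
have -> : (k == a.+1) = false by lia.
by rewrite /pval nth_default //; lia.
Qed.

Lemma len_mulS u a : 0 < a -> bounded_word u ->
  len (mulS u a) + (pval u a.+1 < pval u a) = len u + (pval u a < pval u a.+1).
Proof.
case: a => // a _ Hu; rewrite !lenE -(inversions_ext a.+2 Hu).
set t := ext a.+2 u.
have Ht : size t = maxn (size u) a.+2 by rewrite size_ext.
have Ex : nth 0 t a = pval u a.+1 by rewrite nth_ext //; lia.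
have Ey : nth 0 t a.+1 = pval u a.+2 by rewrite nth_ext //; lia.
(* After padding both positions exist, and [mulS] exchanges two adjacent entries of [t], as in
   [inversions_swap]. *)
have Et : t = take a t ++ nth 0 t a :: nth 0 t a.+1 :: drop a.+2 t.
  by rewrite -!drop_nth ?cat_take_drop //; lia.
have -> : mulS u a.+1 = take a t ++ nth 0 t a.+1 :: nth 0 t a :: drop a.+2 t.
  have Hs : size (take a t) = a by rewrite size_takel; lia.
  apply: (@eq_from_nth _ 0) => [|k].
    by rewrite size_mulS size_cat /= size_drop Hs Ht; lia.
  rewrite size_mulS => Hk.
  rewrite (nth_map 0) ?size_iota -/t ?Ht // nth_iota ?Ht // add0n /= nth_cat Hs.
  case: (ltnP k a) => Hka.
    by rewrite nth_take // !ifF //; lia.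
  case: (k =P a) => [->|Hk1]; first by rewrite subnn.
  case: (k =P a.+1) => [->|Hk2]; first by rewrite subSnn.
  have -> : k - a = (k - a.+2).+2 by lia.
  by rewrite /= nth_drop; congr (nth _ _ _); lia.
by rewrite [in RHS]Et -Ex -Ey inversions_swap.
Qed.

(* On one-line notation, [u * s_a] sorts the entries at positions [a], [a+1]
   decreasingly. *)
Definition fstar (f : nat -> nat) (a k : nat) : nat :=
  if k == a then maxn (f a) (f a.+1)
  else if k == a.+1 then minn (f a) (f a.+1) else f k.

(** By [len_mulS] the length grows exactly at an ascent, where the swap sorts the two entries;
    otherwise they are already weakly decreasing. *)
Lemma pval_star u a : 0 < a -> bounded_word u -> pval (star u a) =1 fstar (pval u) a.
Proof.
move=> Ha Hu k; have := len_mulS Ha Hu; rewrite /star.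
case: eqP => Hl Hs; rewrite ?pval_mulS // /fstar /swap_pos.
  by case: eqP => Hk; [lia | case: eqP => Hk' //; lia].
by case: eqP => [->|Hk]; [lia | case: eqP => [->|Hk'] //; lia].
Qed.

Lemma bounded_mulS u a : bounded_word u -> bounded_word (mulS u a).
Proof.
move=> Hu; rewrite /bounded_word size_mulS; apply/allP => x /mapP[k _ ->].
set j := (if _ then _ else _).
case: (ltnP j (size (ext a.+1 u))) => Hj; last by rewrite nth_default.
rewrite size_ext in Hj; rewrite nth_ext //= .
case: (ltnP j (size u)) => Hju; last by rewrite nth_default.
by apply: leq_trans (allP Hu _ (mem_nth j.+1 Hju)) _; lia.
Qed.

Lemma bounded_star u a : bounded_word u -> bounded_word (star u a).
Proof. by rewrite /star => Hu; case: ifP => // _; apply: bounded_mulS. Qed.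

Lemma eq_fstar f g a : f =1 g -> fstar f a =1 fstar g a.
Proof. by move=> E k; rewrite /fstar !E. Qed.

Lemma eq_foldl_fstar f g w : f =1 g -> foldl fstar f w =1 foldl fstar g w.
Proof. by elim: w f g => //= a w IH f g E; apply/IH/eq_fstar. Qed.

Lemma pval_foldl_star w u : all (fun a => 0 < a) w -> bounded_word u ->
  pval (foldl star u w) =1 foldl fstar (pval u) w.
Proof.
elim: w u => //= a w IH u /andP[Ha Hw] Hu k.
rewrite IH //; last exact: bounded_star.
by apply: eq_foldl_fstar; apply: pval_star.
Qed.

(** * Words with the same action, and the relations of the 0-Hecke monoid *)

Definition weq (u v : seq nat) : Prop :=
  forall f, foldl fstar f u =1 foldl fstar f v.

Lemma weq_refl u : weq u u.
Proof. by []. Qed.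

Lemma weq_sym u v : weq u v -> weq v u.
Proof. by move=> H f k; rewrite H. Qed.

Lemma weq_trans v u w : weq u v -> weq v w -> weq u w.
Proof. by move=> H1 H2 f k; rewrite H1 H2. Qed.

(** Replacing [v] after an arbitrary prefix is possible because [weq] quantifies over every starting
    function, not only the identity. *)
Lemma weq_cat u u' v v' : weq u u' -> weq v v' -> weq (u ++ v) (u' ++ v').
Proof.
move=> Hu Hv f k; rewrite !foldl_cat Hv.
exact: eq_foldl_fstar.
Qed.

Lemma weq_idem a : weq [:: a; a] [:: a].
Proof.
move=> f k /=; rewrite /fstar eqxx.
by do !case: eqP => //; lia.
Qed.

Lemma weq_comm a b : a.+1 < b -> weq [:: a; b] [:: b; a].
Proof.
move=> Hab f k /=; rewrite /fstar.
by do !case: eqP => //; lia.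
Qed.

(** Both words sort the entries at positions [a], [a.+1], [a.+2] decreasingly. *)
Lemma weq_braid a : weq [:: a; a.+1; a] [:: a.+1; a; a.+1].
Proof.
move=> f k /=; rewrite /fstar.
have -> : (a.+1 == a) = false by lia.
have -> : (a.+2 == a) = false by lia.
have -> : (a.+2 == a.+1) = false by lia.
have -> : (a == a.+1) = false by lia.
rewrite !eqxx.
by do !case: eqP => //; lia.
Qed.

Lemma weq_word_comm w b : all (fun a => b.+1 < a) w -> weq (w ++ [:: b]) (b :: w).
Proof.
elim: w => //= a w IH /andP[Ha Hw].
apply: (@weq_trans ([:: a] ++ b :: w)).
  by apply: (@weq_cat [:: a]) => //; apply: IH.
exact: (weq_cat (weq_sym (weq_comm Ha)) (weq_refl w)).
Qed.

(** * Two adjacent rows, read by rows or by columns *)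

Fixpoint rowword (t : pred nat) (j c k : nat) : seq nat :=
  if k is k'.+1 then rowword t j c.+1 k' ++ (if t c then [:: j + c] else [::])
  else [::].

(* Columns [c], ..., [c + k - 1] of two rows, right to left, the top cross of
   column [x] carrying the letter [j + x]; row [i] has offset [j = i - 1]. *)
Fixpoint colword (t b : pred nat) (j c k : nat) : seq nat :=
  if k is k'.+1 then colword t b j c.+1 k' ++
    ((if t c then [:: j + c] else [::]) ++ (if b c then [:: j.+1 + c] else [::]))
  else [::].

Lemma eq_colword t b t' b' j c k :
  (forall x, c <= x -> t x = t' x) -> (forall x, c <= x -> b x = b' x) ->
  colword t b j c k = colword t' b' j c k.
Proof.
elim: k c => //= k IH c Ht Hb; rewrite Ht // Hb //; congr (_ ++ _).
by apply: IH => x Hx; [apply: Ht | apply: Hb]; apply: ltnW.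
Qed.

Lemma rowwordE t j c k :
  rowword t j c k = [seq j + x | x <- rev (iota c k) & t x].
Proof.
elim: k c => //= k IH c; rewrite rev_cons filter_rcons IH.
by case: (t c); rewrite ?cats0 // map_rcons cats1.
Qed.

(** The top letter [j + c] has to pass only the bottom letters of columns [x > c]; these are at
    least [j + c + 2] and commute with it. *)
Lemma weq_rows_cols t b j c k :
  weq (rowword t j c k ++ rowword b j.+1 c k) (colword t b j c k).
Proof.
elim: k c => //= k IH c.
set Rt := rowword t j c.+1 k; set Rb := rowword b j.+1 c.+1 k.
set tc := (if t c then _ else _); set bc := (if b c then _ else _).
have Hc : weq (tc ++ Rb) (Rb ++ tc).
  rewrite /tc; case: (t c); last by rewrite cats0.
  apply/weq_sym/weq_word_comm; rewrite /Rb rowwordE all_map.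
  by apply/allP => x; rewrite mem_filter mem_rev mem_iota /=; lia.
have -> : (Rt ++ tc) ++ Rb ++ bc = Rt ++ (tc ++ Rb) ++ bc by rewrite !catA.
apply: (@weq_trans (Rt ++ (Rb ++ tc) ++ bc)).
  by apply: weq_cat => //; apply: weq_cat.
have -> : Rt ++ (Rb ++ tc) ++ bc = (Rt ++ Rb) ++ tc ++ bc by rewrite !catA.
by apply: weq_cat => //; apply: IH.
Qed.

(** * Slides of two-row words *)

(** Here [J] stands for the T columns among the first ones: those before [m] become L, and [f] tells
    whether the T at [m] is kept or becomes 0. *)
Definition slide_top (t J : pred nat) (m : nat) (f : bool) (c : nat) : bool :=
  t c && ~~ (J c && ((c < m) || (c == m) && ~~ f)).
Definition slide_bot (b J : pred nat) (m c : nat) : bool :=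
  b c || J c && (c < m).

Section Slide.

Variables (t b J : pred nat) (j m : nat).
Hypothesis Jm : J m.
Hypothesis tJ : forall c, J c -> t c.
Hypothesis bJ : forall c, J c -> b c = false.
Hypothesis full : forall c, 0 < c < m -> ~~ J c -> t c && b c.

(** Column [c] is read last, so the extra letter meets it first and then moves on to columns [c.+1],
    ..., [m]. *)
Lemma weq_slide_carry f c k : 0 < c <= m -> m < c + k ->
  weq (colword (slide_top t J m f) (slide_bot b J m) j c k ++ [:: j + c])
      (colword t b j c k).
Proof.
elim: k c => [|k IH] c Hc Hk; first by lia.
rewrite /= -catA; case: (ltngtP c m) => Hcm; last 1 first.
(* At [m] the carried letter becomes the missing T if the column is 0, and is absorbed by
   idempotence if it is T; the columns beyond are unchanged. *)
- rewrite Hcm [X in weq (X ++ _)](@eq_colword _ _ t b) => [|x Hx|x Hx].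
  + apply: weq_cat => //; rewrite /slide_top /slide_bot Jm ltnn eqxx /= tJ // bJ //=.
    by case: (f) => //=; apply: weq_idem.
  + rewrite /slide_top; have -> : (x < m) = false by lia.
    have -> : (x == m) = false by lia.
    by rewrite andbF andbT.
  + rewrite /slide_bot; have -> : (x < m) = false by lia.
    by rewrite andbF orbF.
- have IHc := IH c.+1; rewrite addnS in IHc.
  rewrite {2}/slide_top {2}/slide_bot Hcm /= !andbT.
  have [Jc|Jc] := boolP (J c).
    (* In an L column the incoming letter serves as the restored T, and the letter of the L is the
       one carried on. *)
    rewrite tJ // bJ //= -cat1s catA.
    by apply: weq_cat => //; apply: IHc; lia.
  have /andP[-> ->] := full (c := c) ltac:(lia) Jc.
  rewrite /= addSn.
  (* A B column lets the letter through by the braid relation, raising it by one. *)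
  apply: (@weq_trans (colword (slide_top t J m f) (slide_bot b J m) j c.+1 k ++
      [:: (j + c).+1; j + c; (j + c).+1])).
    by apply: weq_cat => //; apply: weq_braid.
  rewrite -[[:: (j + c).+1; _; _]]cat1s catA.
  by apply: weq_cat => //; apply: IHc; lia.
by lia.
Qed.

(** Both sides agree to the left of the least column [m0] of [J]. If [m0 < m], column [m0] is L on
    one side and 0 on the other, and the letter of the L is carried into the columns to its right,
    restoring them. *)
Lemma weq_slide_first (f : bool) m0 c k :
  (forall x, x < m0 -> J x = false) -> J m0 -> (f -> m0 < m) ->
  0 < c <= m0 -> m < c + k ->
  weq (colword (slide_top t J m f) (slide_bot b J m) j c k)
      (colword (slide_top t J m0 false) (slide_bot b J m0) j c k).
Proof.
move=> Hmin Jm0 Hf; have Hm0 : m0 <= m.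
  by rewrite leqNgt; apply/negP => /Hmin; rewrite Jm.
elim: k c => [|k IH] c Hc Hk; first by lia.
rewrite /=; case: (ltngtP c m0) => Hcm; last 1 first.
- case: (ltngtP m0 m) => [Hlt||Em]; [|by lia|]; last first.
    by case: (f) Hf {IH}; [lia | rewrite Em].
  rewrite Hcm [X in weq _ (X ++ _)](@eq_colword _ _ t b) => [|x Hx|x Hx].
  + rewrite /slide_top /slide_bot Jm0 Hlt ltnn eqxx tJ // bJ //= cats0 addSnnS.
    by apply: weq_slide_carry; lia.
  + rewrite /slide_top; have -> : (x < m0) = false by lia.
    have -> : (x == m0) = false by lia.
    by rewrite andbF andbT.
  + rewrite /slide_bot; have -> : (x < m0) = false by lia.
    by rewrite andbF orbF.
- rewrite {2 4}/slide_top {2 4}/slide_bot Hmin //=.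
  by apply: weq_cat => //; apply: IH; lia.
by lia.
Qed.

End Slide.

(** * The reading order and canonical lists of crosses *)

Lemma rlt_trans : transitive rlt.
Proof. by case=> [a b] [c d] [e f]; rewrite /rlt /=; lia. Qed.

Lemma rlt_irr : irreflexive rlt.
Proof. by case=> [a b]; rewrite /rlt /=; lia. Qed.

Lemma rle_trans : transitive rle.
Proof. by case=> [a b] [c d] [e f]; rewrite /rle /=; lia. Qed.

Lemma mem_mkpd s : mkpd s =i s.
Proof. by move=> x; rewrite mem_sort mem_undup. Qed.

Lemma sorted_mkpd s : sorted rlt (mkpd s).
Proof.
have Hs : sorted rle (mkpd s).
  by apply: sort_sorted => -[a b] [c d]; rewrite /rle /=; lia.
have Hu : uniq (mkpd s) by rewrite sort_uniq undup_uniq.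
rewrite (sorted_pairwise rlt_trans).
rewrite (sorted_pairwise rle_trans) in Hs; rewrite uniq_pairwise in Hu.
have := conj Hu Hs => /andP; rewrite -pairwise_relI; apply: sub_pairwise.
by move=> [a b] [c d]; rewrite /= /rlt /rle xpair_eqE /=; lia.
Qed.

Lemma eq_rlt_sorted s s' : sorted rlt s -> sorted rlt s' -> s =i s' -> s = s'.
Proof. exact: (irr_sorted_eq rlt_trans rlt_irr). Qed.

Lemma eq_mkpd s s' : s =i s' -> mkpd s = mkpd s'.
Proof.
move=> E; apply: eq_rlt_sorted; try exact: sorted_mkpd.
by move=> x; rewrite !mem_mkpd.
Qed.

Lemma mkpd_id s : sorted rlt s -> mkpd s = s.
Proof.
by move=> Hs; apply: eq_rlt_sorted => //; [exact: sorted_mkpd | exact: mem_mkpd].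
Qed.

Lemma pd_wf_mkpd s : (forall x, x \in s -> (0 < x.1) && (0 < x.2)) -> pd_wf (mkpd s).
Proof.
move=> H; rewrite /pd_wf sorted_mkpd; apply/allP => x.
by rewrite mem_mkpd; apply: H.
Qed.

(** * The word of a pipe dream, cut into rows *)

Definition letters (s : seq (nat * nat)) : seq nat := [seq (x.1 + x.2).-1 | x <- s].

(** On a well-formed [D], [mkpd] changes nothing, so [letters D] is the reading word; its letters
    are positive, as [pval_foldl_star] requires. *)
Lemma inPE w D :
  inP w D <-> pd_wf D /\ foldl fstar (pval [::]) (letters D) =1 pval w.
Proof.
suff E : pd_wf D -> pval (demazure D) =1 foldl fstar (pval [::]) (letters D).
  by split=> -[wfD H]; split=> // k; [rewrite -E | rewrite E].
case/andP=> sD /allP pD; rewrite /demazure /readword mkpd_id //.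
apply: pval_foldl_star => //; apply/allP => _ /mapP[x /pD Hx ->]; lia.
Qed.

Lemma split_down_closed (P : pred (nat * nat)) s : sorted rlt s ->
  (forall x y, rlt x y -> P y -> P x) ->
  s = [seq x <- s | P x] ++ [seq x <- s | ~~ P x].
Proof.
move=> + HP; rewrite (sorted_pairwise rlt_trans).
elim: s => //= x s IH /andP[/allP Hx Hs].
have [Px|Px] := boolP (P x); first by rewrite /= -IH.
have Hn : {in s, forall y, ~~ P y}.
  by move=> y /Hx Hxy; apply: contra Px; apply: HP.
by rewrite (eq_in_filter (a2 := pred0)) ?filter_pred0 ?(eq_in_filter (a2 := predT)) ?filter_predT // => y /Hn // /negbTE.
Qed.

Lemma split_rows i s : sorted rlt s ->
  s = [seq x <- s | x.1 < i] ++ [seq x <- s | x.1 == i] ++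
      [seq x <- s | x.1 == i.+1] ++ [seq x <- s | i.+1 < x.1].
Proof.
move=> Hs.
have Hf P : sorted rlt (filter P s) by apply: sorted_filter Hs; exact: rlt_trans.
have Hd n x y : rlt x y -> y.1 < n -> x.1 < n by rewrite /rlt; lia.
rewrite {1}(split_down_closed Hs (Hd i)); congr (_ ++ _).
rewrite (split_down_closed (Hf _) (Hd i.+1)) -!filter_predI; congr (_ ++ _).
  by apply: eq_filter => x /=; lia.
rewrite (split_down_closed (Hf _) (Hd i.+2)) -!filter_predI; congr (_ ++ _).
  by apply: eq_filter => x /=; lia.
by apply: eq_filter => x /=; lia.
Qed.

Lemma letters_row i D N : 0 < i -> pd_wf D -> (forall x, x \in D -> x.2 <= N) ->
  letters [seq x <- D | x.1 == i] = rowword (fun c => (i, c) \in D) i.-1 1 N.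
Proof.
move=> Hi /andP[sD /allP pD] HN; rewrite rowwordE.
have -> : [seq x <- D | x.1 == i] =
    [seq (i, c) | c <- rev (iota 1 N) & (i, c) \in D].
  apply: eq_rlt_sorted; first by apply: sorted_filter sD; exact: rlt_trans.
    rewrite sorted_map; apply: sorted_filter => [a b c|]; first by rewrite /= /rlt /=; lia.
    rewrite rev_sorted; apply: sub_sorted (iota_ltn_sorted 1 N) => x y /=.
    by rewrite /rlt /=; lia.
  move=> [r c]; rewrite mem_filter /=; apply/andP/mapP => [[/eqP -> Dc]|].
    exists c => //; rewrite mem_filter Dc mem_rev mem_iota.
    by have := HN _ Dc; have := pD _ Dc; rewrite /=; lia.
  by case=> c'; rewrite mem_filter => /andP[Dc _] [-> ->].
by rewrite /letters -map_comp; apply: eq_map => c /=; lia.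
Qed.

Lemma weq_letters i D N : 0 < i -> pd_wf D -> (forall x, x \in D -> x.2 <= N) ->
  weq (letters D)
    (letters [seq x <- D | x.1 < i] ++
     colword (fun c => (i, c) \in D) (fun c => (i.+1, c) \in D) i.-1 1 N ++
     letters [seq x <- D | i.+1 < x.1]).
Proof.
move=> Hi wfD HN; have /andP[sD _] := wfD.
rewrite {1}(split_rows i sD) /letters !map_cat; apply: weq_cat => //.
rewrite catA; apply: weq_cat => //.
have := @letters_row i _ _ Hi wfD HN; rewrite /letters => ->.
have := @letters_row i.+1 _ _ isT wfD HN; rewrite /letters => -> /=.
by case: i Hi => // i _; apply: weq_rows_cols.
Qed.

(** * The initial columns of row [i], and mitosis as a family of slides *)

Lemma start_gt0 i D : 0 < start i D.
Proof. by rewrite /start; case: ex_minnP => c /andP[]. Qed.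

Lemma start_notin i D : (i, start i D) \notin D.
Proof. by rewrite /start; case: ex_minnP => c /andP[]. Qed.

Lemma start_le i D c : 0 < c -> (i, c) \notin D -> start i D <= c.
Proof.
by move=> Hc Dc; rewrite /start; case: ex_minnP => s _; apply; rewrite Hc.
Qed.

Lemma lt_start i D c : 0 < c < start i D -> (i, c) \in D.
Proof.
case/andP=> Hc; rewrite ltnNge; apply: contraR; exact: start_le.
Qed.

Lemma start_gt i D m : (forall c, 0 < c <= m -> (i, c) \in D) -> m < start i D.
Proof.
move=> H; rewrite ltnNge; apply/negP => Hs; have := start_notin i D.
by rewrite H // start_gt0.
Qed.

Lemma mem_Jset i D c : (c \in Jset i D) = (0 < c < start i D) && ((i.+1, c) \notin D).
Proof. by rewrite mem_filter mem_iota andbC; have := start_gt0 i D; lia. Qed.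

Lemma Jset_nil i D : (forall c, 0 < c < start i D -> (i.+1, c) \in D) <-> Jset i D = [::].
Proof.
split=> [H|H c Hc].
  case E: (Jset i D) => [//|c s]; have : c \in Jset i D by rewrite E mem_head.
  by rewrite mem_Jset => /andP[/H ->].
by have := mem_Jset i D c; rewrite H Hc /= => /esym/negbFE.
Qed.

Lemma Jset_sorted i D : sorted ltn (Jset i D).
Proof. by apply: (sorted_filter ltn_trans); apply: iota_ltn_sorted. Qed.

Lemma Jset_top i D c : c \in Jset i D -> (i, c) \in D.
Proof. by rewrite mem_Jset => /andP[/lt_start]. Qed.

Lemma Jset_bot i D c : c \in Jset i D -> ((i.+1, c) \in D) = false.
Proof. by rewrite mem_Jset => /andP[_ /negbTE]. Qed.

(* [D_m] for [f = false]; for [f = true], the union of [D_m] with its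
   predecessor in the mitosis. *)
Definition slide (i : nat) (D : seq (nat * nat)) (m : nat) (f : bool) : seq (nat * nat) :=
  mkpd ([seq x <- D | ~~ [&& x.1 == i, x.2 \in Jset i D &
                           (x.2 < m) || (x.2 == m) && ~~ f]]
        ++ [seq (i.+1, c) | c <- Jset i D & c < m]).

Lemma mem_slide i D m f (r c : nat) : ((r, c) \in slide i D m f) =
  ((r, c) \in D) && ~~ [&& r == i, c \in Jset i D & (c < m) || (c == m) && ~~ f]
  || [&& r == i.+1, c \in Jset i D & c < m].
Proof.
rewrite mem_mkpd mem_cat mem_filter andbC; congr (_ || _).
apply/mapP/and3P => [[c']|[/eqP -> Jc Hc]]; last first.
  by exists c => //; rewrite mem_filter Jc andbT.
by rewrite mem_filter => /andP[Hc Jc] [-> ->].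
Qed.

Lemma Dp_slide i D p : p \in Jset i D -> Dp i D p = slide i D p false.
Proof.
rewrite /Dp /slide; move: (Jset i D) => J Jp.
apply: eq_mkpd => -[r c]; rewrite !mem_cat !mem_filter /=; congr (_ || _).
congr (_ && _); rewrite xpair_eqE andbT.
case: (c =P p) => [->|_]; first by rewrite Jp ltnn /= andbF !andbT.
by rewrite andbF orbF.
Qed.

(** For consecutive [a < b] the two dreams differ only in these columns, which are 0, T in the first
    and L, 0 in the second; the union has L, T. *)
Lemma slide_union i D a b : a \in Jset i D -> b \in Jset i D -> a < b ->
  (forall c, c \in Jset i D -> c < b -> c <= a) ->
  mkpd (Dp i D a ++ Dp i D b) = slide i D b true.
Proof.
move=> Ja Jb ab Hab; rewrite -[RHS]mkpd_id ?sorted_mkpd //; apply: eq_mkpd => -[r c].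
rewrite mem_cat !Dp_slide // !mem_slide /= !andbT !andbF orbF.
have [Jc|] := boolP (c \in Jset i D); last by rewrite !andbF !orbF !andbT orbb.
have := Hab _ Jc; have := Jset_bot Jc; have := Jset_top Jc.
case: (r =P i) => [-> -> _|_ _]; first by lia.
by case: (r =P i.+1) => [-> ->|_ _]; lia.
Qed.

(** The condition on [f] excludes the least element of [Jset], which has no predecessor to form a
    union with. *)
Lemma mem_mitosis' i D (E : seq (nat * nat)) : E \in mitosis' i D <->
  exists m (f : bool), [/\ m \in Jset i D, f -> exists2 c, c \in Jset i D & c < m &
                  E = slide i D m f].
Proof.
have := Jset_sorted i D; rewrite /mitosis' /mitosis.
case EJ : (Jset i D) => [|j0 l] /=; first by split=> // -[m [f []]].
have J0 : j0 \in Jset i D by rewrite EJ mem_head.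
have HJ c : c \in Jset i D -> (c <= j0) || (c \in l).
  by rewrite EJ inE => /orP[/eqP ->|->]; rewrite ?leqnn ?orbT.
have Hl : {subset l <= Jset i D} by move=> c Hc; rewrite EJ inE Hc orbT.
move=> Hp; have /allP Hmin := order_path_min ltn_trans Hp.
have Hflat : E \in flatten [seq [:: mkpd (ab.1 ++ ab.2); ab.2] | ab <-
    zip (Dp i D j0 :: [seq Dp i D p | p <- l]) [seq Dp i D p | p <- l]] <->
    exists m f, m \in l /\ E = slide i D m f.
  (* The induction runs over the current head; [HJ] records that no element of [Jset] lies strictly
     between it and the next one in the list. *)
  elim: l j0 J0 HJ Hl Hp {EJ Hmin} => [|b l IH] a Ja HJ Hl /=.
    by move=> _; split=> // -[m [f []]].
  case/andP=> ab Hp; have /allP Hmin := order_path_min ltn_trans Hp.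
  have Jb : b \in Jset i D by apply: Hl; rewrite mem_head.
  have HJb c : c \in Jset i D -> (c <= b) || (c \in l) by move/HJ; rewrite inE; lia.
  have Hlb : {subset l <= Jset i D} by move=> c Hc; apply: Hl; rewrite inE Hc orbT.
  have {}IH := IH b Jb HJb Hlb Hp.
  rewrite !inE slide_union //; last first.
    move=> c /HJ; rewrite inE => /or3P[//|/eqP ->|/Hmin]; rewrite ?ltnn //=.
    by lia.
  rewrite Dp_slide // orbA; split.
    case/orP=> [/orP[]/eqP ->|].
    - by exists b, true; rewrite mem_head.
    - by exists b, false; rewrite mem_head.
    rewrite -Dp_slide //; case/IH=> m [f [Hm ->]].
    by exists m, f; rewrite inE Hm orbT.
  case=> m [f []]; rewrite inE => /orP[/eqP -> ->|Hm EE].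
    by case: f; rewrite eqxx ?orbT.
  apply/orP; right; rewrite -Dp_slide //; apply/IH.
  by exists m, f.
rewrite inE; split.
  case/orP=> [/eqP ->|/Hflat[m [f [Hm ->]]]].
    by exists j0, false; rewrite mem_head Dp_slide.
  exists m, f; split=> //; first by rewrite inE Hm orbT.
  by exists j0; [rewrite mem_head | apply: Hmin].
case=> m [f []]; rewrite inE => /orP[/eqP -> Hf ->|Hm Hf EE]; last first.
  by apply/orP; right; apply/Hflat; exists m, f.
have -> : f = false.
  apply/negP => /Hf[c]; rewrite inE => /orP[/eqP ->|/Hmin /=]; last by lia.
  by rewrite ltnn.
by rewrite Dp_slide ?eqxx.
Qed.

Lemma mem_mitosis i D E :
  E \in mitosis i D <-> exists2 m, m \in Jset i D & E = slide i D m false.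
Proof.
split=> [/mapP[m Jm ->]|[m Jm ->]]; first by exists m; rewrite ?Dp_slide.
by rewrite -Dp_slide //; apply: map_f.
Qed.

Lemma pd_wf_slide i D m f : pd_wf D -> pd_wf (slide i D m f).
Proof.
case/andP=> _ /allP pD; apply: pd_wf_mkpd => x; rewrite mem_cat mem_filter.
case/orP=> [/andP[_ /pD] //|/mapP[c]]; rewrite mem_filter mem_Jset => Hc -> /=.
by lia.
Qed.

(** * Demazure products of slides *)

Section SlideWord.

Variables (i : nat) (D : seq (nat * nat)).
Hypotheses (Hi : 0 < i) (wfD : pd_wf D).

(** One window of columns serves [D] and all its slides, since crosses move only within their
    column. *)
Let N := \max_(x <- D) x.2.

Lemma col_le_max x : x \in D -> x.2 <= N.
Proof. by move=> Dx; apply: (@leq_bigmax_seq _ _ xpredT (fun x => x.2)). Qed.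

Lemma weq_letters_slide m f : weq (letters (slide i D m f))
  (letters [seq x <- D | x.1 < i] ++
   colword (slide_top (fun c => (i, c) \in D) (mem (Jset i D)) m f)
           (slide_bot (fun c => (i.+1, c) \in D) (mem (Jset i D)) m) i.-1 1 N ++
   letters [seq x <- D | i.+1 < x.1]).
Proof.
have wfE := pd_wf_slide i m f wfD.
apply: weq_trans (weq_letters (N := N) Hi wfE _) _ => [[r c]|].
  rewrite mem_slide => /orP[/andP[/col_le_max //]|/and3P[_ Jc _]] /=.
  exact: (col_le_max (Jset_top Jc)).
have sD : sorted rlt D by case/andP: wfD.
have sE : sorted rlt (slide i D m f) by case/andP: wfE.
rewrite (_ : [seq x <- slide i D m f | x.1 < i] = [seq x <- D | x.1 < i]); last first.
  apply: eq_rlt_sorted; try by apply: sorted_filter => //; exact: rlt_trans.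
  move=> [r c]; rewrite !mem_filter mem_slide /=.
  by case: (ltnP r i) => //= Hr; lia.
rewrite (_ : [seq x <- slide i D m f | i.+1 < x.1] = [seq x <- D | i.+1 < x.1]);
  last first.
  apply: eq_rlt_sorted; try by apply: sorted_filter => //; exact: rlt_trans.
  move=> [r c]; rewrite !mem_filter mem_slide /=.
  by case: (ltnP i.+1 r) => //= Hr; lia.
rewrite (@eq_colword _ _ (slide_top (fun c => (i, c) \in D) (mem (Jset i D)) m f)
   (slide_bot (fun c => (i.+1, c) \in D) (mem (Jset i D)) m)) // => c _.
  rewrite mem_slide eqxx /slide_top /=.
  have -> : (i == i.+1) = false by lia.
  by rewrite orbF.
rewrite mem_slide eqxx /slide_bot /=; have -> : (i.+1 == i) = false by lia.
by rewrite andbT.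
Qed.

Let full c m : m \in Jset i D -> 0 < c < m -> ~~ mem (Jset i D) c ->
  ((i, c) \in D) && ((i.+1, c) \in D).
Proof.
rewrite /= !mem_Jset => Hm Hc.
have Hs : 0 < c < start i D by lia.
by rewrite (lt_start Hs) Hs /= negbK.
Qed.

(** The letter [i] commutes past the rows below [i.+1], whose letters are at least [i + 2], and then
    enters the two rows at column 1. *)
Lemma weq_slide_mul m f : m \in Jset i D ->
  weq (letters (slide i D m f) ++ [:: i]) (letters D).
Proof.
move=> Jm.
have HNm : m <= N by exact: (col_le_max (Jset_top Jm)).
apply: (@weq_trans ((letters [seq x <- D | x.1 < i] ++
   colword (slide_top (fun c => (i, c) \in D) (mem (Jset i D)) m f)
           (slide_bot (fun c => (i.+1, c) \in D) (mem (Jset i D)) m) i.-1 1 N ++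
   letters [seq x <- D | i.+1 < x.1]) ++ [:: i])).
  by apply: weq_cat => //; apply: weq_letters_slide.
apply: weq_sym; apply: (weq_trans (weq_letters Hi wfD col_le_max)); apply: weq_sym.
rewrite -!catA; apply: weq_cat => //.
set W := colword _ _ _ _ _; set B := letters _.
apply: (@weq_trans (W ++ [:: i] ++ B)).
  apply: weq_cat => //; apply: weq_word_comm; apply/allP => _ /mapP[x + ->].
  rewrite mem_filter => /andP[Hx Dx]; case/andP: wfD => _ /allP/(_ _ Dx).
  by lia.
rewrite catA; apply: weq_cat => //.
(* With offset [i.-1], the top letter of column 1 is [i]. *)
have -> : [:: i] = [:: i.-1 + 1] by congr [:: _]; lia.
apply: weq_slide_carry => //=.
- by move=> c; apply: Jset_top.
- by move=> c; apply: Jset_bot.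
- by move=> c; apply: full.
by move: Jm; rewrite mem_Jset; lia.
Qed.

(** Each slide is compared with the one that deletes the top cross at the least element of
    [Jset]. *)
Lemma weq_slide_slide m (f : bool) m' (f' : bool) :
  m \in Jset i D -> (f -> exists2 c, c \in Jset i D & c < m) ->
  m' \in Jset i D -> (f' -> exists2 c, c \in Jset i D & c < m') ->
  weq (letters (slide i D m f)) (letters (slide i D m' f')).
Proof.
have exJ : m \in Jset i D -> exists c, c \in Jset i D by exists m.
move=> Jm Hf Jm' Hf'; case: (ex_minnP (exJ Jm)) => m0 J0 Hmin.
suff H n (g : bool) : n \in Jset i D -> (g -> exists2 c, c \in Jset i D & c < n) ->
    weq (letters (slide i D n g)) (letters (slide i D m0 false)).
  by apply: weq_trans (H _ _ Jm Hf) (weq_sym (H _ _ Jm' Hf')).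
move=> Jn Hg; apply: weq_trans (weq_letters_slide n g) _.
apply: weq_sym; apply: weq_trans (weq_letters_slide m0 false) _; apply: weq_sym.
apply: weq_cat => //; apply: weq_cat => //.
apply: weq_slide_first => //=.
- by move=> c; apply: Jset_top.
- by move=> c; apply: Jset_bot.
- by move=> c; apply: full.
- by move=> c Hc; apply/negbTE/negP => /Hmin; lia.
- by case/Hg => c /Hmin; lia.
- by move: J0; rewrite mem_Jset; lia.
by have /= := col_le_max (Jset_top Jn); lia.
Qed.

End SlideWord.

(** * Inverting a slide *)

(** The slide lacks a top cross at [m], or at a smaller element of [Jset] if [f] holds, while the
    columns before [m] are B or L and so have their bottom cross. *)
Lemma slide_Jset_nil i D m (f : bool) :
  m \in Jset i D -> (f -> exists2 c, c \in Jset i D & c < m) ->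
  Jset i (slide i D m f) = [::].
Proof.
move=> Jm Hf; apply/Jset_nil => c Hc.
have Hs : start i (slide i D m f) <= m.
  have Hrow x : x \in Jset i D -> (x < m) || (x == m) && ~~ f ->
      start i (slide i D m f) <= x.
    move=> Jx Hx; apply: start_le; first by move: Jx; rewrite mem_Jset; lia.
    by rewrite mem_slide eqxx Jx Hx; lia.
  case: (f) Hf Hrow => [Hf Hrow|_ Hrow]; last by apply: Hrow; rewrite ?eqxx ?orbT.
  have [x Jx xm] := Hf isT; apply: leq_trans (ltnW xm).
  by apply: Hrow; rewrite ?xm.
rewrite mem_slide eqxx.
have -> : (i.+1 == i) = false by lia.
have -> : c < m by lia.
have [_|] := boolP (c \in Jset i D); first by rewrite !orbT.
have Hcs : 0 < c < start i D by move: Jm; rewrite mem_Jset; lia.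
by rewrite mem_Jset Hcs /= negbK => ->.
Qed.

(** Columns before [m] are B or L, whereas column [m] is T or 0. *)
Lemma first_bot_slide i D m f : m \in Jset i D -> start i.+1 (slide i D m f) = m.
Proof.
move=> Jm; have Hm := Jm; rewrite mem_Jset in Hm.
have H1 : (i.+1 == i) = false by lia.
apply/eqP; rewrite eqn_leq start_le /=; last 2 first.
- by lia.
- by rewrite mem_slide (Jset_bot Jm) ltnn !andbF.
rewrite leqNgt; apply/negP => Hlt.
have := start_notin i.+1 (slide i D m f); rewrite mem_slide eqxx H1 Hlt.
have := start_gt0 i.+1 (slide i D m f); move: (start _ _) Hlt => s Hlt s0.
have [_|] := boolP (s \in Jset i D); first by rewrite !orbT.
have Hs : 0 < s < start i D by lia.
by rewrite mem_Jset Hs /= negbK => ->.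
Qed.

(** To undo the slide, turn each L before [m] back into T and fill the top row up to [m], where [D]
    has all its crosses. As [f] does not enter the formula, [E] and [m] determine [D]. *)
Lemma mem_slide_inv i D m f r c : m \in Jset i D -> 0 < c ->
  let E := slide i D m f in
  ((r, c) \in D) = [|| ((r, c) \in E) && ~~ [&& r == i.+1, c < m & (i, c) \notin E]
                     | (r == i) && (c <= m)].
Proof.
move=> Jm Hc /=; rewrite !mem_slide eqxx.
have -> : (i == i.+1) = false by lia.
have HJc := mem_Jset i D c; have HJm := mem_Jset i D m; rewrite Jm in HJm.
have Hst := @lt_start i D c.
case: (r =P i) => [->|Hr].
  have -> : (i == i.+1) = false by lia.
  rewrite /= !orbF andbT; case: (leqP c m) => Hcm; first by rewrite Hst ?orbT; lia.
  by rewrite orbF ltnNge (ltnW Hcm) gtn_eqF //= andbF andbT.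
case: (r =P i.+1) => [->|Hr'] /=; last by rewrite !orbF !andbT.
rewrite !andbT orbF; case: (ltnP c m) => Hcm; last by rewrite !andbF orbF andbT.
have Hcs : 0 < c < start i D by lia.
rewrite Hst // HJc Hcs /=.
by case: ((i.+1, c) \in D).
Qed.

Lemma slide_inj i D D' m m' f f' : pd_wf D -> pd_wf D' ->
  m \in Jset i D -> m' \in Jset i D' -> slide i D m f = slide i D' m' f' -> D = D'.
Proof.
move=> /andP[sD /allP pD] /andP[sD' /allP pD'] Jm Jm' E.
have Em : m = m' by rewrite -(first_bot_slide f Jm) E first_bot_slide.
apply: eq_rlt_sorted => // -[r c].
case: (posnP c) => [->|Hc].
  by apply/idP/idP => [/pD|/pD']; rewrite andbF.
by rewrite (mem_slide_inv f r Jm Hc) (mem_slide_inv f' r Jm' Hc) E Em.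
Qed.

Lemma slide_surj i E : 0 < i -> pd_wf E -> Jset i E = [::] ->
  exists D m (f : bool), [/\ pd_wf D, m \in Jset i D,
    f -> exists2 c, c \in Jset i D & c < m & E = slide i D m f].
Proof.
move=> Hi /andP[sE /allP pE] JE; pose m := start i.+1 E.
have m0 : 0 < m := start_gt0 _ _.
have Em : (i.+1, m) \notin E := start_notin _ _.
have Elt c : 0 < c < m -> (i.+1, c) \in E := @lt_start _ _ _.
(* The choices of [m] and [D] are forced by [first_bot_slide] and [mem_slide_inv]. *)
pose D := mkpd ([seq x <- E | ~~ [&& x.1 == i.+1, x.2 < m & (i, x.2) \notin E]]
                ++ [seq (i, c) | c <- iota 1 m]).
have memD r c : ((r, c) \in D) =
    ((r, c) \in E) && ~~ [&& r == i.+1, c < m & (i, c) \notin E]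
    || (r == i) && (0 < c <= m).
  rewrite mem_mkpd mem_cat mem_filter andbC; congr (_ || _).
  apply/mapP/andP => [[c']|[/eqP -> Hc]].
    by rewrite mem_iota => Hc' [-> ->]; rewrite eqxx; lia.
  by exists c => //; rewrite mem_iota; lia.
have neq1 : (i.+1 == i) = false by lia.
have neq2 : (i == i.+1) = false by lia.
have wfD : pd_wf D.
  apply: pd_wf_mkpd => x; rewrite mem_cat mem_filter.
  case/orP=> [/andP[_ /pE] //|/mapP[c]]; rewrite mem_iota => Hc -> /=; lia.
have Hst : m < start i D.
  by apply: start_gt => c Hc; rewrite memD eqxx Hc orbT.
have HJ c : (c \in Jset i D) = (0 < c < start i D) &&
    (((i.+1, c) \notin E) || (c < m) && ((i, c) \notin E)).
  by rewrite mem_Jset memD neq1 eqxx /= orbF negb_and negbK.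
exists D, m, ((i, m) \in E); split=> //.
- by rewrite HJ Em m0 Hst.
(* If column [m] of [E] is T, the first missing top cross of [E] lies before [m], since otherwise
   [m] would be in [Jset i E]. That column is L in [E], hence a smaller element of [Jset i D]. *)
- move=> Eim; have Hs := start_notin i E; have s0 := start_gt0 i E.
  have Hsm : start i E < m.
    rewrite ltn_neqAle; apply/andP; split.
      by apply/eqP => Es; rewrite Es Eim in Hs.
    rewrite leqNgt; apply/negP => Hm; have /Jset_nil/(_ m) := JE.
    by rewrite m0 Hm => /(_ isT); rewrite (negbTE Em).
  exists (start i E) => //; rewrite HJ Hs Hsm s0 (ltn_trans Hsm Hst).
  by rewrite orbT.
apply: eq_rlt_sorted => //; first exact: sorted_mkpd.
have E0 r : ((r, 0) \in E) = false by apply/negP => /pE; rewrite andbF.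
move=> [r c]; rewrite mem_slide memD HJ.
case: (posnP c) => [->|Hc]; first by rewrite !E0 !andbF.
case: (r =P i) => [->|Hr].
  rewrite neq2 /= !orbF andbT; case: (ltngtP c m) => Hcm /=.
  - have Hcs : c < start i D by lia.
    by rewrite (Elt c) ?Hc ?Hcm // Hcs orbT /= !andbT negbK.
  - by rewrite orbF !andbF !andbT.
  - by rewrite Hcm orbT Em Hst /= negbK.
case: (r =P i.+1) => [->|Hr'] /=; last by rewrite !orbF !andbT.
rewrite orbF andbT; case: (ltnP c m) => Hcm; last by rewrite !andbF orbF andbT.
have Hcs : c < start i D by lia.
by rewrite Elt ?Hc ?Hcm // Hcs /= negbK andbT orbN.
Qed.

(** * The two decompositions *)

Theorem theorem4p1 (w : seq nat) (i : nat)
    (Hw : perm_eq w (iota 1 (size w))) (Hi : 0 < i)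
    (Hdes : (len (mulS w i)).+1 = len w) :
  ((forall D1 D2 E, P_s w i D1 -> P_s w i D2 ->
      E \in mitosis' i D1 -> E \in mitosis' i D2 -> D1 = D2) /\
   (forall E, inP (mulS w i) E <-> exists D, P_s w i D /\ E \in mitosis' i D)) /\
  ((forall D1 D2 E, P_I w i D1 -> P_I w i D2 ->
      E \in mitosis' i D1 -> E \in mitosis' i D2 -> D1 = D2) /\
   (forall E, P_empty w i E <-> exists D, P_I w i D /\ E \in mitosis' i D)).
Proof.
have desc : pval w i.+1 < pval w i.
  have Hb : bounded_word w.
    by apply/allP => x; rewrite (perm_mem Hw) mem_iota; lia.
  by have := len_mulS Hi Hb; lia.
have disj D1 D2 E : pd_wf D1 -> pd_wf D2 ->
    E \in mitosis' i D1 -> E \in mitosis' i D2 -> D1 = D2.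
  move=> w1 w2 /mem_mitosis'[m [f [Jm _ ->]]] /mem_mitosis'[m' [f' [Jm' _ ES]]].
  exact: slide_inj ES.
have propagate v D E E' : pd_wf D -> E \in mitosis' i D -> E' \in mitosis' i D ->
    inP v E -> inP v E'.
  move=> wfD /mem_mitosis'[m [f [Jm Hf ->]]] /mem_mitosis'[m' [f' [Jm' Hf' ->]]].
  rewrite !inPE => -[_ H]; split; first exact: pd_wf_slide.
  by move=> k; rewrite -H (weq_slide_slide Hi wfD Jm Hf Jm' Hf').
have sub D E : E \in mitosis i D -> E \in mitosis' i D.
  by case/mem_mitosis => m Jm ->; apply/mem_mitosis'; exists m, false.
have head_mit D E : E \in mitosis' i D -> exists E', E' \in mitosis i D.
  case/mem_mitosis' => m [f [Jm _ _]]; exists (slide i D m false).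
  by apply/mem_mitosis; exists m.
have notnil D E : E \in mitosis' i D -> Jset i D <> [::].
  by case/mem_mitosis' => m [f [Jm _ _]] JN; rewrite JN in Jm.
have up D E v : pd_wf D -> E \in mitosis' i D -> inP v E ->
    foldl fstar (pval [::]) (letters D) =1 fstar (pval v) i.
  move=> wfD /mem_mitosis'[m [f [Jm Hf ->]]] /inPE[_ H] k.
  rewrite -(weq_slide_mul Hi wfD f Jm) foldl_cat /=.
  exact: eq_fstar.
have surj E : pd_wf E -> Jset i E = [::] ->
    exists D, pd_wf D /\ E \in mitosis' i D.
  move=> wfE JE; have [D [m [f [wfD Jm Hf ->]]]] := slide_surj Hi wfE JE.
  by exists D; split=> //; apply/mem_mitosis'; exists m, f.
(* Both [w] and [mulS w i] are sent to [w] by the generator, so in both parts [up] shows that the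
   preimage [D] has Demazure product [w]. *)
have starw : fstar (pval w) i =1 pval w.
  by move=> k; rewrite /fstar; case: eqP => [->|_]; [lia | case: eqP => [->|_]; lia].
have starws : fstar (pval (mulS w i)) i =1 pval w.
  move=> k; rewrite /fstar !pval_mulS // /swap_pos eqxx.
  have -> : (i.+1 == i) = false by lia.
  rewrite eqxx; case: eqP => [->|_]; first by lia.
  by case: eqP => [->|_]; lia.
split; split.
- by move=> D1 D2 E [/inPE[w1 _] _ _] [/inPE[w2 _] _ _]; apply: disj.
- move=> E; split=> [PE|[D [[/inPE[wfD _] _ HD] HE]]]; last first.
    (* [P_s] speaks of [mitosis] only; [propagate] extends it to the unions. *)
    have [E' HE'] := head_mit _ _ HE.
    exact: (propagate _ _ _ _ wfD (sub _ _ HE') HE (HD _ HE')).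
  have /inPE[wfE HE] := PE.
  have JE : Jset i E = [::].
    (* If [Jset i E] were nonempty, the word of [E] would be equivalent to one ending in [i], giving
       weakly decreasing values at [i], [i.+1]; but [mulS w i] has an ascent there. *)
    case EJ: (Jset i E) => [//|m s].
    have Jm : m \in Jset i E by rewrite EJ mem_head.
    have Hk k := weq_slide_mul Hi wfE false Jm (pval [::]) k.
    have := Hk i; have := Hk i.+1; rewrite !HE !(pval_mulS _ _ Hi) foldl_cat.
    move: (foldl fstar _ (letters _)) => g; rewrite /foldl /fstar /swap_pos !eqxx.
    have -> : (i.+1 == i) = false by lia.
    by move=> H1 H2; exfalso; lia.
  have [D [wfD ED]] := surj _ wfE JE; exists D; split=> //; split.
  + by apply/inPE; split=> // k; rewrite (up _ _ _ wfD ED PE) starws.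
  + exact: notnil ED.
  by move=> E' /sub HE'; apply: (propagate _ _ _ _ wfD ED HE' PE).
- by move=> D1 D2 E [/inPE[w1 _] _ _] [/inPE[w2 _] _ _]; apply: disj.
(* The argument repeats with [w] in place of [mulS w i]; [Jset i E] is now empty by assumption in
   one direction and by [slide_Jset_nil] in the other. *)
move=> E; split=> [[PE JE]|[D [[/inPE[wfD _] _ HD] HE]]]; last first.
  have [E' HE'] := head_mit _ _ HE; split.
    exact: (propagate _ _ _ _ wfD (sub _ _ HE') HE (HD _ HE')).
  by case/mem_mitosis': HE => m [f [Jm Hf ->]]; apply: slide_Jset_nil.
have /inPE[wfE HE] := PE.
have [D [wfD ED]] := surj _ wfE JE; exists D; split=> //; split.
+ by apply/inPE; split=> // k; rewrite (up _ _ _ wfD ED PE) starw.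
+ exact: notnil ED.
by move=> E' /sub HE'; apply: (propagate _ _ _ _ wfD ED HE' PE).
Qed.
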